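(* $$\sum_{k=0}^\infty\frac{\binom{2k}{k}}{(2k+1)16^k}\left(3S_1(2k+1)+\frac{4}{2k+1}\right)=8C.$$
   Context: $S_1(n):=\sum_{i=1}^n \frac1i$ is the $n$-th harmonic number, and $C=\sum_{k=0}^\infty \frac{(-1)^k}{(2k+1)^2}$ is Catalan's constant. *)

(* Defs.v *)
From Stdlib Require Import Reals Lra Lia.
From Coquelicot Require Import Coquelicot.

Open Scope R_scope.

(* [sum_n_m a 1 0] is the empty sum, so [S1 0 = 0]. *)
Definition S1 (n : nat) : R := sum_n_m (fun i : nat => 1 / INR i) 1 n.

Definition Catalan : R :=
  Series (fun k : nat => (-1) ^ k / INR (2 * k + 1) ^ 2).

(* [Series] is total; here the series converges, so [Catalan] is its sum. *)
Lemma is_series_Catalan :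
  is_series (fun k : nat => (-1) ^ k / INR (2 * k + 1) ^ 2) Catalan.
Proof.
apply Series_correct.
assert (pos : forall k, 0 < INR (2 * k + 1)) by (intro k; apply lt_0_INR; lia).
destruct (alternated_series (fun k => / INR (2 * k + 1) ^ 2)) as [l Hl].
- intro k. apply Rinv_le_contravar; [apply pow_lt, pos|].
  apply pow_incr; split; [apply Rlt_le, pos | apply le_INR; lia].
- apply is_lim_seq_Reals.
  apply is_lim_seq_le_le with (u := fun _ => 0) (w := fun k => / INR (S k)).
  + intro k. split; [apply Rlt_le, Rinv_0_lt_compat, pow_lt, pos|].
    apply Rinv_le_contravar; [apply lt_0_INR; lia|].
    rewrite <- pow_INR. apply le_INR. simpl. nia.
  + apply is_lim_seq_const.
  + apply (is_lim_seq_incr_1 (fun k => / INR k)).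
    apply (is_lim_seq_inv INR p_infty); [apply is_lim_seq_INR | discriminate].
- exists l. apply is_series_Reals. exact Hl.
Qed.

(* Main.v *)
Require Import Defs.
From Stdlib Require Import Reals Lra Lia Factorial.
From Coquelicot Require Import Coquelicot.

Open Scope R_scope.

(** Put [phi s = 2 arcsin (s / 2)], whose coefficients are
    [b k = C(2k, k) / ((2k + 1) 16^k)], and
    [n t = integral of 2 u cot u over [0, t]]. Everything is expressed through
    [n], called [cot_int] below, whose derivative is elementary and whose series
    in [2 sin t] has the coefficients [b k / (2 k + 1)].

    - At [t = PI/6], where [2 sin t = 1], this gives
      [sum b k / (2 k + 1) = n (PI/6)] ([sum_cot_int_coef]).
    - Since [S1 m] is the integral of [(1 - s^m) / (1 - s)] over [[0, 1]], the
      sum of [b k * S1 (2 k + 1)] is the integral of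
      [(phi 1 - phi s) / (1 - s)]. The substitution [s = 2 sin t] and
      integration by parts express it by [n] at [PI/12], [5 PI/12] and [PI/3]
      ([sum_harmonic]).
    - The triplication formula of the sine gives [n (PI/12) + n (5 PI/12)] in
      terms of [n (PI/4)] ([cot_int_triplication]).
    - Catalan's constant is the integral of [atan x / x] over [[0, 1]]; with
      [x = tan t] the integrand becomes [t (cot t + tan t)], so the constant is
      a combination of [n] at [PI/4], [PI/6] and [PI/3] ([Catalan_cot_int]).

    In [3 sum b k S1 (2 k + 1) + 4 sum b k / (2 k + 1)] the logarithms and the
    values of [n] then combine to eight times the last expression. The
    functions involved are continuous on closed intervals, so integrals are
    replaced throughout by increments of antiderivatives, compared through
    their derivatives. *)

(** * Increments and their termwise summation *)

(** Comparing derivatives only on the open interval matters: the derivatives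
    met below are quotients that degenerate at an end point. *)
Lemma dominated_increment (f f' h h' : R -> R) (a b : R) :
  a < b ->
  (forall x, a < x < b -> is_derive f x (f' x)) ->
  (forall x, a <= x <= b -> continuous f x) ->
  (forall x, a < x < b -> is_derive h x (h' x)) ->
  (forall x, a <= x <= b -> continuous h x) ->
  (forall x, a < x < b -> Rabs (f' x) <= h' x) ->
  Rabs (f b - f a) <= h b - h a.
Proof.
intros ab df cf dh ch H.
assert (up : forall k k' : R -> R,
  (forall x, a < x < b -> is_derive k x (k' x)) ->
  (forall x, a <= x <= b -> continuous k x) ->
  (forall x, a < x < b -> 0 <= k' x) -> 0 <= k b - k a).
{ intros k k' dk ck pos.
  assert (pr : forall c, a < c < b -> derivable_pt k c).
  { intros c Hc. apply ex_derive_Reals_0. exists (k' c). now apply dk. }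
  assert (ck' : forall c, a <= c <= b -> continuity_pt k c).
  { intros c Hc. apply continuity_pt_filterlim. now apply ck. }
  destruct (MVT k id a b pr (fun c _ => derivable_pt_id c) ab ck'
    (fun c _ => derivable_continuous_pt _ _ (derivable_pt_id c))) as [c [Hc E]].
  rewrite derive_pt_id, (derive_pt_eq_0 _ _ (k' c)) in E by (apply is_derive_Reals; now apply dk).
  unfold id in E. specialize (pos c Hc). nra. }
apply Rabs_le. split.
- enough (0 <= (h b + f b) - (h a + f a)) by lra.
  apply (up (fun x => h x + f x) (fun x => h' x + f' x)).
  + intros x Hx. apply (is_derive_plus h f); auto.
  + intros x Hx. apply (continuous_plus h f); auto.
  + intros x Hx. generalize (H x Hx). intro K. apply Rabs_le_between in K. lra.
- enough (0 <= (h b - f b) - (h a - f a)) by lra.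
  apply (up (fun x => h x - f x) (fun x => h' x - f' x)).
  + intros x Hx. apply (is_derive_minus h f); auto.
  + intros x Hx. apply (continuous_minus h f); auto.
  + intros x Hx. generalize (H x Hx). intro K. apply Rabs_le_between in K. lra.
Qed.

Lemma equal_ends (f : R -> R) (a b : R) :
  a < b ->
  (forall x, a < x < b -> is_derive f x 0) ->
  (forall x, a <= x <= b -> continuous f x) ->
  f a = f b.
Proof.
intros ab df cf.
assert (K : Rabs (f b - f a) <= 0 - 0).
{ apply (dominated_increment f (fun _ => 0) (fun _ => 0) (fun _ => 0)); auto.
  - intros. apply (is_derive_const 0).
  - intros. apply continuous_const.
  - intros. rewrite Rabs_R0. lra. }
apply Rabs_le_between in K. lra.
Qed.

Lemma is_series_tail_le (u c : nat -> R) (l m : R) :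
  (forall k, Rabs (u k) <= c k) -> is_series u l -> is_series c m ->
  forall n, Rabs (sum_n u n - l) <= m - sum_n c n.
Proof.
intros uc Hu Hc n.
assert (split_at : forall (v : nat -> R) (s : R), is_series v s ->
  s = sum_n v n + Series (fun k => v (S n + k)%nat)).
{ intros v s Hv. rewrite <- (is_series_unique _ _ Hv), sum_n_Reals.
  apply (Series_incr_n v (S n)); [lia | now exists s]. }
rewrite (split_at u l Hu), (split_at c m Hc).
assert (tail : ex_series (fun k => c (S n + k)%nat))
  by (apply (ex_series_incr_n c (S n)); now exists m).
assert (tail' : ex_series (fun k => Rabs (u (S n + k)%nat))).
{ apply (ex_series_le (K := R_AbsRing) (V := R_CompleteNormedModule) _ (fun k => c (S n + k)%nat)).
  - intro k. unfold norm; simpl; unfold abs; simpl. rewrite Rabs_Rabsolu. apply uc.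
  - exact tail. }
set (su := sum_n u n). set (sc := sum_n c n).
set (tu := Series (fun k => u (S n + k)%nat)). set (tc := Series (fun k => c (S n + k)%nat)).
replace (su - (su + tu)) with (- tu) by ring.
replace (sc + tc - sc) with tc by ring.
rewrite Rabs_Ropp.
apply Rle_trans with (Series (fun k => Rabs (u (S n + k)%nat))).
- now apply Series_Rabs.
- apply Series_le; [|exact tail]. intro k. split; [apply Rabs_pos | apply uc].
Qed.

Lemma is_series_of_error (u e : nat -> R) (l : R) :
  (forall n, Rabs (sum_n u n - l) <= e n) -> is_lim_seq e 0 -> is_series u l.
Proof.
intros H He.
assert (K : is_lim_seq (fun n => sum_n u n - l) 0).
{ apply is_lim_seq_abs_0.
  apply is_lim_seq_le_le with (u := fun _ => 0) (w := e); auto.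
  - intro n. split; [apply Rabs_pos | apply H].
  - apply is_lim_seq_const. }
change (is_lim_seq (sum_n u) l).
apply is_lim_seq_ext with (fun n => (sum_n u n - l) + l); [intro; ring|].
replace (Finite l) with (Finite (0 + l)) by (f_equal; ring).
apply is_lim_seq_plus'; [exact K | apply is_lim_seq_const].
Qed.

Lemma continuous_sum_n (f : nat -> R -> R) (n : nat) (x : R) :
  (forall k, continuous (f k) x) -> continuous (fun y => sum_n (fun k => f k y) n) x.
Proof.
intro H. induction n as [|n IH].
- apply continuous_ext with (f 0%nat); [intro; now rewrite sum_O | apply H].
- apply continuous_ext with (fun y => sum_n (fun k => f k y) n + f (S n) y);
    [intro; now rewrite sum_Sn|].
  now apply (continuous_plus (fun y => sum_n (fun k => f k y) n) (f (S n))).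
Qed.

Lemma sum_n_minus (u v : nat -> R) (n : nat) :
  sum_n (fun k => u k - v k) n = sum_n u n - sum_n v n.
Proof.
induction n as [|n IH]; [now rewrite !sum_O|].
rewrite !sum_Sn, IH. unfold plus; simpl. ring.
Qed.

(** Termwise integration of a dominated series, stated without integrals: by
    the Weierstrass test the derivative of the [n]-th remainder is at most the
    tail of [c], so its increment over [[a, b]] tends to 0. *)
Lemma is_series_increments (f f' : nat -> R -> R) (g g' : R -> R)
    (c : nat -> R) (a b : R) :
  a < b ->
  (forall k x, a <= x <= b -> is_derive (f k) x (f' k x)) ->
  (forall x, a < x < b -> is_derive g x (g' x)) ->
  (forall x, a <= x <= b -> continuous g x) ->
  (forall k x, a < x < b -> Rabs (f' k x) <= c k) ->
  ex_series c ->
  (forall x, a < x < b -> is_series (fun k => f' k x) (g' x)) ->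
  is_series (fun k => f k b - f k a) (g b - g a).
Proof.
intros ab df dg cg bound [m Hm] sums.
assert (cf : forall k x, a <= x <= b -> continuous (f k) x).
{ intros k x Hx. apply (ex_derive_continuous (f k)). exists (f' k x). now apply df. }
apply is_series_of_error with (fun n => (m - sum_n c n) * b - (m - sum_n c n) * a).
- intro n. rewrite sum_n_minus.
  replace (_ - _ - _) with ((sum_n (fun k => f k b) n - g b) - (sum_n (fun k => f k a) n - g a))
    by ring.
  apply (dominated_increment (fun x => sum_n (fun k => f k x) n - g x)
    (fun x => sum_n (fun k => f' k x) n - g' x)
    (fun x => (m - sum_n c n) * x) (fun _ => m - sum_n c n)); auto.
  + intros x Hx. apply (is_derive_minus (fun x => sum_n (fun k => f k x) n) g); auto.
    apply (is_derive_sum_n f n x (fun k => f' k x)). intros k _. apply df. lra.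
  + intros x Hx. apply (continuous_minus (fun x => sum_n (fun k => f k x) n) g); auto.
    apply continuous_sum_n. auto.
  + intros x _. auto_derive; [trivial | ring].
  + intros x _. apply (ex_derive_continuous (fun x => (m - sum_n c n) * x)).
    auto_derive. trivial.
  + intros x Hx. apply is_series_tail_le; auto.
- apply is_lim_seq_ext with (fun n => (m - sum_n c n) * (b - a)); [intro; ring|].
  replace (Finite 0) with (Rbar_mult (Finite 0) (Finite (b - a))) by (simpl; f_equal; ring).
  apply is_lim_seq_scal_r.
  replace 0 with (m - m) by ring.
  apply is_lim_seq_minus'; [apply is_lim_seq_const | exact Hm].
Qed.

(** * Power series with central binomial coefficients *)

Lemma odd_pos (k : nat) : 0 < INR (2 * k + 1).
Proof. apply lt_0_INR. lia. Qed.

Lemma odd_INR (k : nat) : INR (2 * k + 1) = 2 * INR k + 1.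
Proof. rewrite plus_INR, mult_INR. simpl. ring. Qed.

Lemma central_binomial_S (k : nat) :
  (INR k + 1) * Binomial.C (2 * S k) (S k) = 2 * INR (2 * k + 1) * Binomial.C (2 * k) k.
Proof.
unfold Binomial.C.
replace (2 * S k - S k)%nat with (S k) by lia.
replace (2 * k - k)%nat with k by lia.
replace (2 * S k)%nat with (S (S (2 * k))) by lia.
change (fact (S (S (2 * k)))) with (S (S (2 * k)) * (S (2 * k) * fact (2 * k)))%nat.
change (fact (S k)) with (S k * fact k)%nat.
rewrite !mult_INR, odd_INR, !S_INR, mult_INR. simpl (INR 2).
field. split; [apply INR_fact_neq_0 | pose proof (pos_INR k); lra].
Qed.

Lemma central_binomial_bounds (k : nat) : 0 <= Binomial.C (2 * k) k <= 4 ^ k.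
Proof.
induction k as [|k IH].
- unfold Binomial.C; simpl. lra.
- pose proof (central_binomial_S k) as E. rewrite odd_INR in E. pose proof (pos_INR k).
  set (x := Binomial.C (2 * S k) (S k)) in *. set (y := Binomial.C (2 * k) k) in *.
  simpl (4 ^ S k). split; apply Rmult_le_reg_l with (INR k + 1); nra.
Qed.

(** Coefficients of [1 / sqrt (1 - y / 4)] in [y], and those obtained from it
    by one and two divisions by [2 k + 1]: the second ones give
    [2 arcsin (x / 2)] as an odd series in [x], the third ones [cot_int]. *)
Definition inv_cos_coef (k : nat) : R := Binomial.C (2 * k) k / 16 ^ k.
Definition arcsin_coef (k : nat) : R := inv_cos_coef k / INR (2 * k + 1).
Definition cot_int_coef (k : nat) : R := arcsin_coef k / INR (2 * k + 1).

Lemma inv_cos_coef_bounds (k : nat) : 0 <= inv_cos_coef k <= / 4 ^ k.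
Proof.
unfold inv_cos_coef. destruct (central_binomial_bounds k) as [H0 H1].
assert (P : 0 < 4 ^ k) by (apply pow_lt; lra).
replace (16 ^ k) with (4 ^ k * 4 ^ k) by (rewrite <- Rpow_mult_distr; f_equal; ring).
split.
- apply Rdiv_le_0_compat; [exact H0 | nra].
- apply Rle_div_l; [nra|].
  replace (/ 4 ^ k * (4 ^ k * 4 ^ k)) with (4 ^ k) by (field; lra). exact H1.
Qed.

Lemma div_odd_bounds (a r : R) (k : nat) : 0 <= a <= r -> 0 <= a / INR (2 * k + 1) <= r.
Proof.
intros H. pose proof (odd_pos k) as P. pose proof (pos_INR k).
split; [now apply Rdiv_le_0_compat|].
apply Rle_div_l; [exact P|]. rewrite odd_INR. nra.
Qed.

Lemma arcsin_coef_bounds (k : nat) : 0 <= arcsin_coef k <= / 4 ^ k.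
Proof. apply div_odd_bounds, inv_cos_coef_bounds. Qed.

Lemma cot_int_coef_bounds (k : nat) : 0 <= cot_int_coef k <= / 4 ^ k.
Proof. apply div_odd_bounds, arcsin_coef_bounds. Qed.

Lemma arcsin_coef_odd (k : nat) : INR (2 * k + 1) * arcsin_coef k = inv_cos_coef k.
Proof. unfold arcsin_coef. field. apply Rgt_not_eq, odd_pos. Qed.

Lemma cot_int_coef_odd (k : nat) : INR (2 * k + 1) * cot_int_coef k = arcsin_coef k.
Proof. unfold cot_int_coef. field. apply Rgt_not_eq, odd_pos. Qed.

(** The recurrence behind the differential equation
    [(8 - 2 y) Z'(y) = Z(y)] of [Z(y) = 1 / sqrt (1 - y / 4)]. *)
Lemma inv_cos_coef_S (k : nat) : INR (S k) * inv_cos_coef (S k) = / 8 * (INR (2 * k + 1) * inv_cos_coef k).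
Proof.
unfold inv_cos_coef. rewrite S_INR. unfold Rdiv at 1. rewrite <- Rmult_assoc, central_binomial_S.
simpl (16 ^ S k). field. apply pow_nonzero. lra.
Qed.

(** The terms [a k * 4 ^ k] are bounded by 1. *)
Lemma CV_radius_ge_4 (a : nat -> R) :
  (forall k, 0 <= a k <= / 4 ^ k) -> Rbar_le 4 (CV_radius a).
Proof.
intro H. apply (proj1 (CV_radius_bounded a)). exists 1. intro k.
specialize (H k). assert (P : 0 < 4 ^ k) by (apply pow_lt; lra).
rewrite Rabs_pos_eq by nra.
apply Rle_trans with (/ 4 ^ k * 4 ^ k); [nra|].
rewrite Rinv_l; lra.
Qed.

Lemma inside_radius (a : nat -> R) (y : R) :
  (forall k, 0 <= a k <= / 4 ^ k) -> 0 <= y < 4 -> Rbar_lt (Rabs y) (CV_radius a).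
Proof.
intros Ha Hy. apply Rbar_lt_le_trans with 4; [simpl; rewrite Rabs_pos_eq; lra|].
now apply CV_radius_ge_4.
Qed.

Lemma PSeries_odd (a : nat -> R) (y : R) :
  Rbar_lt (Rabs y) (CV_radius a) ->
  PSeries (fun k => INR (2 * k + 1) * a k) y
  = PSeries a y + 2 * y * PSeries (PS_derive a) y.
Proof.
intro H.
rewrite Rmult_assoc, <- PSeries_incr_1, <- PSeries_scal.
rewrite <- PSeries_plus.
- apply PSeries_ext. intro k. rewrite odd_INR.
  unfold PS_plus, PS_scal, PS_incr_1, PS_derive, plus, scal; simpl; unfold mult; simpl.
  destruct k as [|k]; [change (@zero _) with 0; simpl INR; ring|]. rewrite S_INR. destruct k; simpl; ring.
- now apply CV_radius_inside.
- apply ex_pseries_scal; [apply Rmult_comm|].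
  apply ex_pseries_incr_1, CV_radius_inside. now rewrite CV_radius_derive.
Qed.

(** [x * PSeries a (x ^ 2)] is the odd power series with coefficients [a];
    differentiating it multiplies [a k] by [2 k + 1]. *)
Lemma is_derive_odd_series (a : nat -> R) (x : R) :
  Rbar_lt (Rabs (x ^ 2)) (CV_radius a) ->
  is_derive (fun x => x * PSeries a (x ^ 2)) x
    (PSeries (fun k => INR (2 * k + 1) * a k) (x ^ 2)).
Proof.
intro H. rewrite PSeries_odd by exact H.
pose proof (is_derive_PSeries a (x ^ 2) H) as D.
auto_derive; [now exists (PSeries (PS_derive a) (x ^ 2)); simpl in * |].
replace (x * (x * 1)) with (x ^ 2) by ring.
assert (D' : Derive (fun y : R => PSeries a y) (x ^ 2) = PSeries (PS_derive a) (x ^ 2))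
  by exact (is_derive_unique _ _ _ D).
rewrite D'. ring.
Qed.

Lemma sin_sqr_lt (t : R) : Rabs t < PI / 2 -> 0 <= (2 * sin t) ^ 2 < 4 /\ 0 < cos t.
Proof.
intro H. apply Rabs_def2 in H.
assert (0 < cos t) by (apply cos_gt_0; lra).
pose proof (sin2_cos2 t) as E. unfold Rsqr in E. simpl. split; [nra | assumption].
Qed.


(** The binomial series of [1 / sqrt (1 - y / 4)] at [y = 4 sin^2 t]. Its
    differential equation makes the derivative of the left-hand side vanish. *)
Lemma inv_cos_coef_sum (t : R) : Rabs t < PI / 2 -> PSeries inv_cos_coef ((2 * sin t) ^ 2) * cos t = 1.
Proof.
assert (ode : forall y, 0 <= y < 4 ->
  (8 - 2 * y) * PSeries (PS_derive inv_cos_coef) y = PSeries inv_cos_coef y).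
{ intros y Hy. pose proof (PSeries_odd inv_cos_coef y (inside_radius inv_cos_coef y inv_cos_coef_bounds Hy)) as E.
  assert (F : PSeries (PS_derive inv_cos_coef) y = / 8 * PSeries (fun k => INR (2 * k + 1) * inv_cos_coef k) y).
  { rewrite <- PSeries_scal. apply PSeries_ext. intro k. apply inv_cos_coef_S. }
  lra. }
set (f := fun t => PSeries inv_cos_coef ((2 * sin t) ^ 2) * cos t).
assert (df : forall u, Rabs u < PI / 2 -> is_derive f u 0).
{ intros u Hu. destruct (sin_sqr_lt u Hu) as [Hy Hc].
  pose proof (is_derive_PSeries inv_cos_coef _ (inside_radius inv_cos_coef _ inv_cos_coef_bounds Hy)) as D.
  pose proof (ode _ Hy) as E. pose proof (sin2_cos2 u) as S. unfold Rsqr in S.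
  unfold f. auto_derive; [now exists (PSeries (PS_derive inv_cos_coef) ((2 * sin u) ^ 2))|].
  replace (2 * sin u * (2 * sin u * 1)) with ((2 * sin u) ^ 2) by ring.
  assert (D' : Derive (fun y : R => PSeries inv_cos_coef y) ((2 * sin u) ^ 2)
    = PSeries (PS_derive inv_cos_coef) ((2 * sin u) ^ 2)) by exact (is_derive_unique _ _ _ D).
  rewrite D', <- E.
  set (Q := PSeries (PS_derive inv_cos_coef) ((2 * sin u) ^ 2)).
  replace (_ + _) with (8 * Q * sin u * (sin u * sin u + cos u * cos u - 1)) by ring.
  rewrite S. ring. }
intro Ht. apply Rabs_def2 in Ht.
replace 1 with (f 0) by (unfold f; rewrite sin_0, cos_0;
  replace ((2 * 0) ^ 2) with 0 by ring; rewrite PSeries_0; unfold inv_cos_coef, Binomial.C; simpl; field).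
change (f t = f 0).
assert (cf : forall u, Rabs u < PI / 2 -> continuous f u).
{ intros u Hu. apply (ex_derive_continuous f). exists 0. now apply df. }
destruct (Rtotal_order t 0) as [L | [-> | L]]; [| reflexivity |].
- apply equal_ends; [exact L | |]; intros u Hu; [apply df | apply cf]; apply Rabs_def1; lra.
- symmetry. apply equal_ends; [exact L | |]; intros u Hu; [apply df | apply cf]; apply Rabs_def1; lra.
Qed.

(** * The integral of 2 u cot u *)

Lemma is_derive_odd_series_sin (a a' : nat -> R) (t : R) :
  (forall k, 0 <= a k <= / 4 ^ k) -> (forall k, INR (2 * k + 1) * a k = a' k) ->
  Rabs t < PI / 2 ->
  is_derive (fun t => 2 * sin t * PSeries a ((2 * sin t) ^ 2)) t
    (2 * cos t * PSeries a' ((2 * sin t) ^ 2)).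
Proof.
intros Ha Ha' Ht.
apply (is_derive_comp (fun x => x * PSeries a (x ^ 2)) (fun t => 2 * sin t)).
- rewrite <- (PSeries_ext _ _ _ Ha'). apply is_derive_odd_series.
  apply inside_radius; [exact Ha | now apply sin_sqr_lt].
- auto_derive; [trivial | ring].
Qed.

(** The arcsine series: by [inv_cos_coef_sum], twice the left-hand side has
    derivative [2]. *)
Lemma arcsin_coef_sum (t : R) :
  Rabs t < PI / 2 -> sin t * PSeries arcsin_coef ((2 * sin t) ^ 2) = t.
Proof.
set (f := fun t => 2 * sin t * PSeries arcsin_coef ((2 * sin t) ^ 2) - 2 * t).
assert (df : forall u, Rabs u < PI / 2 -> is_derive f u 0).
{ intros u Hu. replace 0 with (2 * (PSeries inv_cos_coef ((2 * sin u) ^ 2) * cos u) - 2)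
    by (rewrite inv_cos_coef_sum; [ring | exact Hu]).
  replace (2 * (_ * _)) with (2 * cos u * PSeries inv_cos_coef ((2 * sin u) ^ 2)) by ring.
  apply (is_derive_minus (fun t => 2 * sin t * PSeries arcsin_coef ((2 * sin t) ^ 2)) (fun t => 2 * t)).
  - apply is_derive_odd_series_sin; [apply arcsin_coef_bounds | apply arcsin_coef_odd | exact Hu].
  - auto_derive; [trivial | ring]. }
assert (cf : forall u, Rabs u < PI / 2 -> continuous f u).
{ intros u Hu. apply (ex_derive_continuous f). exists 0. now apply df. }
intro Ht. apply Rabs_def2 in Ht.
enough (E : f t = f 0) by (unfold f in E; rewrite sin_0 in E; lra).
destruct (Rtotal_order t 0) as [L | [-> | L]]; [| reflexivity |].
- apply equal_ends; [exact L | |]; intros u Hu; [apply df | apply cf]; apply Rabs_def1; lra.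
- symmetry. apply equal_ends; [exact L | |]; intros u Hu; [apply df | apply cf]; apply Rabs_def1; lra.
Qed.

(** The function [t |-> integral of 2 u cot u over [0, t]]. The series form is
    smooth at 0, where the closed form of the derivative is undefined. *)
Definition cot_int (t : R) : R := 2 * sin t * PSeries cot_int_coef ((2 * sin t) ^ 2).

Lemma cot_int_0 : cot_int 0 = 0.
Proof. unfold cot_int. rewrite sin_0. ring. Qed.

Lemma continuous_cot_int (t : R) : Rabs t < PI / 2 -> continuous cot_int t.
Proof.
intro H. apply (ex_derive_continuous cot_int). eexists.
apply is_derive_odd_series_sin; [apply cot_int_coef_bounds | apply cot_int_coef_odd | exact H].
Qed.

Lemma is_derive_cot_int (t : R) :
  0 < t < PI / 2 -> is_derive cot_int t (2 * t * cos t / sin t).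
Proof.
intro H. assert (Ht : Rabs t < PI / 2) by (rewrite Rabs_pos_eq; lra).
assert (S : 0 < sin t) by (apply sin_gt_0; lra).
replace (2 * t * cos t / sin t) with (2 * cos t * PSeries arcsin_coef ((2 * sin t) ^ 2)).
- apply is_derive_odd_series_sin; [apply cot_int_coef_bounds | apply cot_int_coef_odd | exact Ht].
- rewrite <- (arcsin_coef_sum t Ht) at 3. field. lra.
Qed.

Lemma is_derive_cot_int_comp (v : R -> R) (t v' : R) :
  is_derive v t v' -> 0 < v t < PI / 2 ->
  is_derive (fun t => cot_int (v t)) t (v' * (2 * v t * cos (v t) / sin (v t))).
Proof. intros D H. apply (is_derive_comp cot_int v); [now apply is_derive_cot_int | exact D]. Qed.

Lemma continuous_cot_int_comp (v : R -> R) (t : R) :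
  ex_derive v t -> Rabs (v t) < PI / 2 -> continuous (fun t => cot_int (v t)) t.
Proof.
intros D H. apply (continuous_comp v cot_int);
  [now apply (ex_derive_continuous v) | now apply continuous_cot_int].
Qed.

Lemma sum_cot_int_coef : is_series cot_int_coef (cot_int (PI / 6)).
Proof.
unfold cot_int. rewrite sin_PI6. replace (2 * (1 / 2)) with 1 by field.
rewrite Rmult_1_l, pow1.
assert (H : ex_pseries cot_int_coef 1).
{ apply CV_radius_inside, inside_radius; [apply cot_int_coef_bounds | lra]. }
apply PSeries_correct, is_pseries_R in H.
apply is_series_ext with (2 := H). intro k. rewrite pow1. simpl. ring.
Qed.

Lemma sum_arcsin_coef_pow (t : R) :
  Rabs t < PI / 2 -> is_series (fun k => arcsin_coef k * (2 * sin t) ^ (2 * k + 1)) (2 * t).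
Proof.
intro Ht.
assert (H : ex_pseries arcsin_coef ((2 * sin t) ^ 2)).
{ apply CV_radius_inside, inside_radius; [apply arcsin_coef_bounds | now apply sin_sqr_lt]. }
apply PSeries_correct, is_pseries_R in H.
replace (2 * t) with ((2 * sin t) * PSeries arcsin_coef ((2 * sin t) ^ 2))
  by (rewrite <- (arcsin_coef_sum t Ht) at 3; ring).
apply (is_series_scal (2 * sin t)) in H.
apply is_series_ext with (2 := H). intro k.
change (2 * sin t * (arcsin_coef k * ((2 * sin t) ^ 2) ^ k) = arcsin_coef k * (2 * sin t) ^ (2 * k + 1)).
rewrite pow_add, pow_mult. ring.
Qed.

(** * The series with harmonic numbers *)

(** Partial sums of [- ln (1 - s)], with their derivatives; at [s = 1] they
    are harmonic numbers. *)
Definition log_sum (m : nat) (s : R) : R := sum_n_m (fun j => s ^ j / INR j) 1 m.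
Definition geom_sum (m : nat) (s : R) : R := sum_n_m (fun j => s ^ pred j) 1 m.

Lemma log_sum_S (m : nat) (s : R) : log_sum (S m) s = log_sum m s + s ^ S m / INR (S m).
Proof. unfold log_sum. rewrite sum_n_Sm; [reflexivity | lia]. Qed.

Lemma geom_sum_S (m : nat) (s : R) : geom_sum (S m) s = geom_sum m s + s ^ m.
Proof. unfold geom_sum. rewrite sum_n_Sm; [reflexivity | lia]. Qed.

Lemma log_sum_1 (m : nat) : log_sum m 1 = S1 m.
Proof. apply sum_n_m_ext. intro k. now rewrite pow1. Qed.

Lemma log_sum_0 (m : nat) : log_sum m 0 = 0.
Proof.
induction m as [|m IH].
- unfold log_sum. now rewrite sum_n_m_zero by lia.
- rewrite log_sum_S, IH. simpl. unfold Rdiv. ring.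
Qed.

Lemma is_derive_log_sum (m : nat) (s : R) : is_derive (log_sum m) s (geom_sum m s).
Proof.
induction m as [|m IH].
- apply is_derive_ext with (fun _ => 0);
    [intro; unfold log_sum; now rewrite sum_n_m_zero by lia|].
  unfold geom_sum; rewrite sum_n_m_zero by lia. apply (is_derive_const 0).
- apply is_derive_ext with (fun s => log_sum m s + s ^ S m / INR (S m));
    [intro; now rewrite log_sum_S|].
  rewrite geom_sum_S. apply (is_derive_plus (log_sum m) (fun s => s ^ S m / INR (S m))); [exact IH|].
  auto_derive; [trivial|]. field. exact (not_0_INR (S m) (Nat.neq_succ_0 m)).
Qed.

Lemma geom_sum_geometric (m : nat) (s : R) : (1 - s) * geom_sum m s = 1 - s ^ m.
Proof.
induction m as [|m IH].
- unfold geom_sum. rewrite sum_n_m_zero by lia. change (@zero _) with 0. simpl. ring.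
- rewrite geom_sum_S, Rmult_plus_distr_l, IH. simpl. ring.
Qed.

Lemma geom_sum_bounds (m : nat) (s : R) : 0 <= s <= 1 -> 0 <= geom_sum m s <= INR m.
Proof.
intro Hs. induction m as [|m IH].
- unfold geom_sum. rewrite sum_n_m_zero by lia. change (@zero _) with 0. simpl. lra.
- rewrite geom_sum_S, S_INR.
  assert (0 <= s ^ m) by (apply pow_le; lra).
  assert (s ^ m <= 1 ^ m) by (apply pow_incr; lra). rewrite pow1 in *. lra.
Qed.

Lemma ex_series_inv_cos_coef : ex_series inv_cos_coef.
Proof.
apply (ex_series_le (K := R_AbsRing) (V := R_CompleteNormedModule) _ (fun k => (/ 4) ^ k)).
- intro k. destruct (inv_cos_coef_bounds k). unfold norm; simpl; unfold abs; simpl.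
  rewrite Rabs_pos_eq, pow_inv; lra.
- apply ex_series_geom. rewrite Rabs_pos_eq; lra.
Qed.

(** An antiderivative of [2 cos t (PI/3 - 2 t) / (1 - 2 sin t)], which is
    [(phi 1 - phi s) / (1 - s) * ds/dt] for [s = 2 sin t] and
    [phi s = 2 arcsin (s / 2)]. It comes from integration by parts and
    [1 - 2 sin t = 4 sin u sin v] with [u = PI/12 - t/2] and
    [v = 5 PI/12 - t/2]; since [v - u = PI/3] the logarithms of [sin u], which
    are singular at [t = PI/6], cancel. *)
Definition harmonic_antideriv (t : R) : R :=
  4 * PI / 3 * ln (sin (5 * PI / 12 - t / 2))
  - 2 * cot_int (PI / 12 - t / 2) - 2 * cot_int (5 * PI / 12 - t / 2).

Lemma is_derive_harmonic_antideriv (t : R) :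
  0 <= t < PI / 6 ->
  is_derive harmonic_antideriv t (2 * cos t * (PI / 3 - 2 * t) / (1 - 2 * sin t)).
Proof.
intro H. pose proof PI_RGT_0 as pi.
set (u := PI / 12 - t / 2). set (v := 5 * PI / 12 - t / 2).
assert (Hu : 0 < u < PI / 2) by (unfold u; lra).
assert (Hv : 0 < v < PI / 2) by (unfold v; lra).
assert (Su : 0 < sin u) by (apply sin_gt_0; lra).
assert (Sv : 0 < sin v) by (apply sin_gt_0; lra).
assert (E1 : cos t = sin u * cos v + cos u * sin v).
{ rewrite <- sin_plus. replace (u + v) with (PI / 2 - t) by (unfold u, v; lra).
  now rewrite sin_shift. }
assert (E2 : 1 - 2 * sin t = 4 * sin u * sin v).
{ assert (A : cos (v - u) = 1 / 2).
  { replace (v - u) with (PI / 3) by (unfold u, v; lra). apply cos_PI3. }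
  assert (B : cos (u + v) = sin t).
  { replace (u + v) with (PI / 2 - t) by (unfold u, v; lra). apply cos_shift. }
  rewrite cos_minus in A. rewrite cos_plus in B. lra. }
rewrite E2.
replace (_ / _) with (- (2 * PI / 3) * (cos v / sin v)
   - 2 * (- / 2 * (2 * u * cos u / sin u)) - 2 * (- / 2 * (2 * v * cos v / sin v))).
- apply (is_derive_minus (fun t => 4 * PI / 3 * ln (sin (5 * PI / 12 - t / 2))
    - 2 * cot_int (PI / 12 - t / 2)) (fun t => 2 * cot_int (5 * PI / 12 - t / 2))).
  apply (is_derive_minus (fun t => 4 * PI / 3 * ln (sin (5 * PI / 12 - t / 2)))
    (fun t => 2 * cot_int (PI / 12 - t / 2))).
  + auto_derive; [exact Sv|]. change (5 * PI / 12 + - (t * / 2)) with v. field. lra.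
  + apply is_derive_scal, (is_derive_cot_int_comp (fun t => PI / 12 - t / 2)); [|exact Hu].
    auto_derive; [trivial | field].
  + apply is_derive_scal, (is_derive_cot_int_comp (fun t => 5 * PI / 12 - t / 2)); [|exact Hv].
    auto_derive; [trivial | field].
- rewrite E1. replace (PI / 3 - 2 * t) with (4 * u) by (unfold u; lra).
  replace v with (u + PI / 3) at 3 by (unfold u, v; lra). field. lra.
Qed.

(** Termwise integration over [0 <= t <= PI/6], with [s = 2 sin t] running from
    0 to 1: the harmonic number is the integral of [1 + s + ... + s^(2k)], and
    the integrands sum to [(phi 1 - phi s) / (1 - s)] by the arcsine series. *)
Lemma sum_harmonic :
  is_series (fun k => arcsin_coef k * S1 (2 * k + 1))
    (harmonic_antideriv (PI / 6) - harmonic_antideriv 0).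
Proof.
pose proof PI_RGT_0 as pi.
assert (S : forall t, 0 < t < PI / 6 -> 0 < sin t < 1 / 2 /\ 0 < cos t <= 1).
{ intros t Ht. split; split.
  - apply sin_gt_0; lra.
  - rewrite <- sin_PI6. apply sin_increasing_1; lra.
  - apply cos_gt_0; lra.
  - apply COS_bound. }
apply is_series_ext with (fun k => arcsin_coef k * log_sum (2 * k + 1) (2 * sin (PI / 6))
  - arcsin_coef k * log_sum (2 * k + 1) (2 * sin 0)).
{ intro k. rewrite sin_PI6, sin_0, Rmult_0_r, log_sum_0.
  replace (2 * (1 / 2)) with 1 by field. rewrite log_sum_1.
  change (arcsin_coef k * S1 (2 * k + 1) - arcsin_coef k * 0 = arcsin_coef k * S1 (2 * k + 1)). ring. }
apply (is_series_increments (fun k t => arcsin_coef k * log_sum (2 * k + 1) (2 * sin t))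
  (fun k t => arcsin_coef k * (2 * cos t * geom_sum (2 * k + 1) (2 * sin t)))
  harmonic_antideriv (fun t => 2 * cos t * (PI / 3 - 2 * t) / (1 - 2 * sin t))
  (fun k => 2 * inv_cos_coef k)).
- lra.
- intros k x _. apply is_derive_scal.
  apply (is_derive_comp (log_sum (2 * k + 1)) (fun t => 2 * sin t)).
  + apply is_derive_log_sum.
  + auto_derive; [trivial | ring].
- intros x Hx. apply is_derive_harmonic_antideriv. lra.
- intros x Hx.
  apply (continuous_minus (fun t => 4 * PI / 3 * ln (sin (5 * PI / 12 - t / 2))
    - 2 * cot_int (PI / 12 - t / 2)) (fun t => 2 * cot_int (5 * PI / 12 - t / 2)));
    [apply (continuous_minus (fun t => 4 * PI / 3 * ln (sin (5 * PI / 12 - t / 2)))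
    (fun t => 2 * cot_int (PI / 12 - t / 2)))|].
  + apply (ex_derive_continuous (fun t => 4 * PI / 3 * ln (sin (5 * PI / 12 - t / 2)))).
    auto_derive. apply sin_gt_0; lra.
  + apply (continuous_scal_r 2 (fun t => cot_int (PI / 12 - t / 2))), continuous_cot_int_comp;
      [now auto_derive | apply Rabs_def1; lra].
  + apply (continuous_scal_r 2 (fun t => cot_int (5 * PI / 12 - t / 2))), continuous_cot_int_comp;
      [now auto_derive | apply Rabs_def1; lra].
- intros k x Hx. destruct (S x Hx) as [Hs Hc].
  pose proof (geom_sum_bounds (2 * k + 1) (2 * sin x)) as G. rewrite <- arcsin_coef_odd.
  pose proof (arcsin_coef_bounds k).
  assert (0 <= geom_sum (2 * k + 1) (2 * sin x) <= INR (2 * k + 1)) by (apply G; lra).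
  rewrite Rabs_pos_eq by (apply Rmult_le_pos; nra).
  replace (2 * (INR (2 * k + 1) * arcsin_coef k)) with (arcsin_coef k * (2 * INR (2 * k + 1))) by ring.
  apply Rmult_le_compat_l; nra.
- apply (ex_series_scal_l 2 inv_cos_coef), ex_series_inv_cos_coef.
- intros x Hx. destruct (S x Hx) as [Hs Hc].
  assert (A : is_series (fun k => arcsin_coef k * (2 * sin (PI / 6)) ^ (2 * k + 1)) (2 * (PI / 6)))
    by (apply sum_arcsin_coef_pow; rewrite Rabs_pos_eq; lra).
  assert (B : is_series (fun k => arcsin_coef k * (2 * sin x) ^ (2 * k + 1)) (2 * x))
    by (apply sum_arcsin_coef_pow; rewrite Rabs_pos_eq; lra).
  pose proof (is_series_scal (2 * cos x / (1 - 2 * sin x)) _ _ (is_series_minus _ _ _ _ A B)) as K.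
  replace (2 * cos x * _ / _) with (scal (2 * cos x / (1 - 2 * sin x)) (minus (2 * (PI / 6)) (2 * x)))
    by (unfold scal, minus, plus, opp; simpl; unfold mult; simpl; field; lra).
  apply is_series_ext with (2 := K). intro k.
  change (2 * cos x / (1 - 2 * sin x)
      * (arcsin_coef k * (2 * sin (PI / 6)) ^ (2 * k + 1) - arcsin_coef k * (2 * sin x) ^ (2 * k + 1))
    = arcsin_coef k * (2 * cos x * geom_sum (2 * k + 1) (2 * sin x))).
  replace (2 * sin (PI / 6)) with 1 by (rewrite sin_PI6; field).
  rewrite pow1.
  pose proof (geom_sum_geometric (2 * k + 1) (2 * sin x)) as G.
  replace ((2 * sin x) ^ (2 * k + 1)) with (1 - (1 - 2 * sin x) * geom_sum (2 * k + 1) (2 * sin x)) by lra.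
  field. lra.
Qed.

(** * Triplication *)

(** From [sin 3t = 4 sin t sin (PI/3 + t) sin (PI/3 - t)]: logarithmic
    differentiation shows that the combination [f] below has derivative 0, and
    its values at 0 and [PI/12] give the relation. *)
Lemma cot_int_triplication :
  cot_int (PI / 12) + cot_int (5 * PI / 12)
  = 4 / 3 * cot_int (PI / 4) + 2 * PI / 3 * (ln (sin (5 * PI / 12)) - ln (sin (PI / 4))).
Proof.
pose proof PI_RGT_0 as pi.
set (L := fun t => ln (sin (PI / 3 + t)) - ln (sin (PI / 3 - t))).
set (f := fun t => / 6 * cot_int (3 * t)
  - / 2 * (cot_int t + cot_int (PI / 3 + t) - cot_int (PI / 3 - t)) + PI / 3 * L t).
assert (E : f 0 = f (PI / 12)).
{ apply equal_ends; [lra | |].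
  - intros t Ht.
    set (x := PI / 3 + t). set (y := PI / 3 - t).
    assert (0 < sin t) by (apply sin_gt_0; lra).
    assert (0 < sin x) by (apply sin_gt_0; unfold x; lra).
    assert (0 < sin y) by (apply sin_gt_0; unfold y; lra).
    set (D := fun v => 2 * v * cos v / sin v).
    assert (Z : 0 = / 6 * (3 * D (3 * t)) - / 2 * (1 * D t + 1 * D x - (-1) * D y)
      + PI / 3 * (cos x / sin x + cos y / sin y)).
    { pose proof (sin2_cos2 t) as S. unfold Rsqr in S.
      assert (S3 : sin (PI / 3) * sin (PI / 3) = 3 / 4).
      { pose proof (sin2_cos2 (PI / 3)) as Q. unfold Rsqr in Q. rewrite cos_PI3 in Q. lra. }
      assert (E0 : sin x * sin y = 3 / 4 * (cos t * cos t) - / 4 * (sin t * sin t)).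
      { unfold x, y. rewrite sin_plus, sin_minus, cos_PI3.
        replace (_ * _) with ((sin (PI / 3) * sin (PI / 3)) * (cos t * cos t)
          - / 4 * (sin t * sin t)) by field.
        now rewrite S3. }
      assert (E1 : sin (3 * t) = 4 * sin t * (sin x * sin y)).
      { rewrite E0. replace (3 * t) with (t + 2 * t) by ring.
        rewrite sin_plus, sin_2a, cos_2a. field. }
      assert (E2 : 3 * cos (3 * t)
        = 4 * (cos t * (sin x * sin y) + sin t * (cos x * sin y - cos y * sin x))).
      { rewrite E0. replace (cos x * sin y - cos y * sin x) with (- sin (2 * t)).
        - replace (3 * t) with (t + 2 * t) by ring.
          rewrite cos_plus, sin_2a, cos_2a. field.
        - rewrite <- sin_neg. replace (- (2 * t)) with (y - x) by (unfold x, y; ring).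
          rewrite sin_minus. ring. }
      unfold D.
      replace (/ 6 * (3 * (2 * (3 * t) * cos (3 * t) / sin (3 * t))))
        with (t * (3 * cos (3 * t)) / sin (3 * t))
        by (field; rewrite E1; repeat apply Rmult_integral_contrapositive_currified; lra).
      rewrite E1, E2. clear E0 E1 E2.
      generalize dependent (sin x). generalize (cos x). intros cx sx Hsx.
      generalize dependent (sin y). generalize (cos y). intros cy sy Hsy.
      unfold x, y. field. lra. }
    rewrite Z. unfold f.
    apply (is_derive_plus (fun t => / 6 * cot_int (3 * t)
      - / 2 * (cot_int t + cot_int (PI / 3 + t) - cot_int (PI / 3 - t))) (fun t => PI / 3 * L t)).
    + apply (is_derive_minus (fun t => / 6 * cot_int (3 * t))
        (fun t => / 2 * (cot_int t + cot_int (PI / 3 + t) - cot_int (PI / 3 - t))));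
      apply is_derive_scal; [|apply (is_derive_minus (fun t => cot_int t + cot_int (PI / 3 + t))
        (fun t => cot_int (PI / 3 - t)));
        [apply (is_derive_plus (fun t => cot_int t) (fun t => cot_int (PI / 3 + t)))|]].
      * apply (is_derive_cot_int_comp (fun t => 3 * t)); [auto_derive; [trivial | ring] | lra].
      * apply (is_derive_cot_int_comp (fun t => t)); [auto_derive; [trivial | ring] | lra].
      * apply (is_derive_cot_int_comp (fun t => PI / 3 + t)); [auto_derive; [trivial | ring] | lra].
      * apply (is_derive_cot_int_comp (fun t => PI / 3 - t)); [auto_derive; [trivial | ring] | lra].
    + apply is_derive_scal. unfold L. auto_derive; [now repeat split|].
      change (PI / 3 + - t) with y. fold x. field. lra.
  - intros t Ht. unfold f.
    assert (C : forall v : R -> R, ex_derive v t -> Rabs (v t) < PI / 2 ->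
      continuous (fun t => cot_int (v t)) t) by (intros; now apply continuous_cot_int_comp).
    apply (continuous_plus (fun t => / 6 * cot_int (3 * t)
      - / 2 * (cot_int t + cot_int (PI / 3 + t) - cot_int (PI / 3 - t))) (fun t => PI / 3 * L t)).
    + apply (continuous_minus (fun t => / 6 * cot_int (3 * t))
        (fun t => / 2 * (cot_int t + cot_int (PI / 3 + t) - cot_int (PI / 3 - t)))).
      * apply (continuous_scal_r (/ 6) (fun t => cot_int (3 * t))), (C (fun t => 3 * t));
          [now auto_derive | apply Rabs_def1; lra].
      * apply (continuous_scal_r (/ 2)
          (fun t => cot_int t + cot_int (PI / 3 + t) - cot_int (PI / 3 - t))).
        apply (continuous_minus (fun t => cot_int t + cot_int (PI / 3 + t))
          (fun t => cot_int (PI / 3 - t))); [apply (continuous_plus (fun t => cot_int t)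
          (fun t => cot_int (PI / 3 + t)))|].
        -- apply (C (fun t => t)); [now auto_derive | apply Rabs_def1; lra].
        -- apply (C (fun t => PI / 3 + t)); [now auto_derive | apply Rabs_def1; lra].
        -- apply (C (fun t => PI / 3 - t)); [now auto_derive | apply Rabs_def1; lra].
    + apply (ex_derive_continuous (fun t => PI / 3 * L t)). unfold L. auto_derive.
      repeat split; apply sin_gt_0; lra. }
unfold f, L in E.
replace (3 * (PI / 12)) with (PI / 4) in E by field.
replace (PI / 3 + PI / 12) with (5 * PI / 12) in E by field.
replace (PI / 3 - PI / 12) with (PI / 4) in E by field.
replace (PI / 3 + 0) with (PI / 3) in E by ring.
replace (PI / 3 - 0) with (PI / 3) in E by ring.
rewrite Rmult_0_r, cot_int_0 in E. lra.
Qed.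

(** * Catalan's constant *)

Lemma sum_n_eq_0 (u : nat -> R) (n : nat) : (forall k, u k = 0) -> sum_n u n = 0.
Proof.
intro H. induction n as [|n IH]; [now rewrite sum_O|].
rewrite sum_Sn, IH, H. exact (Rplus_0_l 0).
Qed.

Definition atan_sum (n : nat) (x : R) : R :=
  sum_n (fun k => (-1) ^ k * x ^ (2 * k + 1) / INR (2 * k + 1)) n.

(** The derivatives of the two functions differ by [y^(2n+2) / (1 + y^2)] in
    absolute value. *)
Lemma atan_sum_error (n : nat) (x : R) :
  0 < x -> Rabs (atan_sum n x - atan x) <= x ^ (2 * n + 3) / INR (2 * n + 3).
Proof.
intro Hx.
assert (D : forall m y, is_derive (fun y => y ^ S m / INR (S m)) y (y ^ m)).
{ intros m y. auto_derive; [trivial|]. field. exact (not_0_INR (S m) (Nat.neq_succ_0 m)). }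
assert (G : forall y, (1 + y ^ 2) * sum_n (fun k => (-1) ^ k * y ^ (2 * k)) n
   = 1 + (-1) ^ n * y ^ (2 * n + 2)).
{ intro y. induction n as [|m IH].
  - rewrite sum_O. simpl. ring.
  - rewrite sum_Sn. unfold plus; simpl plus. rewrite Rmult_plus_distr_l, IH.
    replace (2 * S m)%nat with (2 * m + 2)%nat by lia.
    rewrite (pow_add y (2 * m + 2) 2). simpl ((-1) ^ S m). simpl (y ^ 2). ring. }
assert (K : Rabs ((atan_sum n x - atan x) - (atan_sum n 0 - atan 0))
   <= x ^ (2 * n + 3) / INR (2 * n + 3) - 0 ^ (2 * n + 3) / INR (2 * n + 3)).
{ assert (dA : forall y, is_derive (fun y => atan_sum n y - atan y) y
    (sum_n (fun k => (-1) ^ k * y ^ (2 * k)) n - / (1 + y ^ 2))).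
  { intro y. apply (is_derive_minus (atan_sum n) atan).
    - apply (is_derive_sum_n (fun k y => (-1) ^ k * y ^ (2 * k + 1) / INR (2 * k + 1)) n y
        (fun k => (-1) ^ k * y ^ (2 * k))).
      intros k _.
      apply is_derive_ext with (fun y => (-1) ^ k * (y ^ (2 * k + 1) / INR (2 * k + 1)));
        [intro; symmetry; apply Rmult_assoc|].
      apply is_derive_scal. replace (2 * k + 1)%nat with (S (2 * k)) by lia. apply D.
    - apply is_derive_Reals. apply derivable_pt_lim_atan. }
  assert (dP : forall y, is_derive (fun y => y ^ (2 * n + 3) / INR (2 * n + 3)) y
    (y ^ (2 * n + 2))).
  { intro y. replace (2 * n + 3)%nat with (S (2 * n + 2)) by lia. apply D. }
  apply (dominated_increment (fun y => atan_sum n y - atan y)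
    (fun y => sum_n (fun k => (-1) ^ k * y ^ (2 * k)) n - / (1 + y ^ 2))
    (fun y => y ^ (2 * n + 3) / INR (2 * n + 3)) (fun y => y ^ (2 * n + 2)));
    auto.
  - intros y _. apply (ex_derive_continuous (fun y => atan_sum n y - atan y)).
    eexists. apply dA.
  - intros y _. apply (ex_derive_continuous (fun y => y ^ (2 * n + 3) / INR (2 * n + 3))).
    eexists. apply dP.
  - intros y Hy. assert (P : 0 <= y ^ (2 * n + 2)) by (apply pow_le; lra).
    replace (_ - _) with ((-1) ^ n * (y ^ (2 * n + 2) / (1 + y ^ 2))).
    + rewrite Rabs_mult, pow_1_abs, Rmult_1_l.
      rewrite Rabs_pos_eq by (apply Rdiv_le_0_compat; [exact P | nra]).
      apply Rle_div_l; nra.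
    + apply Rmult_eq_reg_l with (1 + y ^ 2); [|nra].
      rewrite Rmult_minus_distr_l, G. field. nra. }
replace (atan_sum n 0) with 0 in K.
- rewrite atan_0, pow_i in K by lia. unfold Rdiv in *. rewrite Rmult_0_l in K.
  rewrite !Rminus_0_r in K. exact K.
- symmetry. apply sum_n_eq_0. intro k. rewrite pow_i by lia. unfold Rdiv. ring.
Qed.

(** Partial sums of the inverse tangent integral
    [integral of atan u / u over [0, x]]; at [x = 1] they are those of
    Catalan's constant. *)
Definition ti2_sum (n : nat) (x : R) : R :=
  sum_n (fun k => (-1) ^ k * x ^ (2 * k + 1) / INR (2 * k + 1) ^ 2) n.

Lemma is_derive_ti2_sum (n : nat) (x : R) :
  0 < x -> is_derive (ti2_sum n) x (atan_sum n x / x).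
Proof.
intro Hx. unfold Rdiv at 1. rewrite Rmult_comm.
unfold atan_sum.
replace (/ x * _) with (sum_n (fun k => / x * ((-1) ^ k * x ^ (2 * k + 1) / INR (2 * k + 1))) n).
2:{ exact (sum_n_mult_l (K := R_Ring) (/ x) _ n). }
apply (is_derive_sum_n (fun k y => (-1) ^ k * y ^ (2 * k + 1) / INR (2 * k + 1) ^ 2) n x
  (fun k => / x * ((-1) ^ k * x ^ (2 * k + 1) / INR (2 * k + 1)))).
intros k _. pose proof (odd_pos k) as P.
auto_derive; [trivial|].
replace (Init.Nat.pred (k + (k + 0) + 1)) with (2 * k)%nat by lia.
replace (k + (k + 0) + 1)%nat with (2 * k + 1)%nat by lia.
rewrite pow_add. field. lra.
Qed.

(** [t / (sin t * cos t)] is the integrand [atan x / x dx] for [x = tan t]. The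
    bound on the error, unlike the terms of the series, is uniform up to
    [x = 1], so Catalan's constant is reached without an Abel theorem. *)
Lemma ti2_sum_error (n : nat) (g : R -> R) (a b : R) :
  0 <= a -> a < b -> b <= PI / 4 ->
  (forall t, a < t < b -> is_derive g t (t / (sin t * cos t))) ->
  (forall t, a <= t <= b -> continuous g t) ->
  Rabs (ti2_sum n (tan b) - ti2_sum n (tan a) - (g b - g a)) <= 2 / INR (2 * n + 3) * (b - a).
Proof.
intros Ha Hab Hb dg cg. pose proof PI_RGT_0 as pi.
assert (P : 0 < INR (2 * n + 3)) by (apply lt_0_INR; lia).
assert (Cos : forall t, a <= t <= b -> 0 < cos t) by (intros; apply cos_gt_0; lra).
replace (ti2_sum n (tan b) - ti2_sum n (tan a) - (g b - g a))
  with ((ti2_sum n (tan b) - g b) - (ti2_sum n (tan a) - g a)) by ring.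
rewrite Rmult_minus_distr_l.
apply (dominated_increment (fun t => ti2_sum n (tan t) - g t)
  (fun t => (tan t ^ 2 + 1) * (atan_sum n (tan t) / tan t) - t / (sin t * cos t))
  (fun t => 2 / INR (2 * n + 3) * t) (fun _ => 2 / INR (2 * n + 3))); auto.
- intros t Ht.
  apply (is_derive_minus (fun t => ti2_sum n (tan t)) g); [|auto].
  apply (is_derive_comp (ti2_sum n) tan).
  + apply is_derive_ti2_sum, tan_gt_0; lra.
  + apply is_derive_tan. apply Rgt_not_eq, Cos. lra.
- intros t Ht. apply (continuous_minus (fun t => ti2_sum n (tan t)) g); [|auto].
  apply (continuous_comp tan (ti2_sum n)).
  + apply (ex_derive_continuous tan). eexists. apply is_derive_tan.
    apply Rgt_not_eq, Cos, Ht.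
  + apply continuous_sum_n. intro k.
    apply (ex_derive_continuous (fun x => (-1) ^ k * x ^ (2 * k + 1) / INR (2 * k + 1) ^ 2)).
    auto_derive. trivial.
- intros t _. generalize (2 / INR (2 * n + 3)). intro r. auto_derive; [trivial | ring].
- intros t _. apply (ex_derive_continuous (fun t => 2 / INR (2 * n + 3) * t)).
  auto_derive. trivial.
- intros t Ht. set (x := tan t).
  assert (Hx : 0 < x) by (apply tan_gt_0; lra).
  assert (Hx1 : x <= 1).
  { unfold x. rewrite <- tan_PI4. apply Rlt_le, tan_increasing; lra. }
  assert (St : 0 < sin t) by (apply sin_gt_0; lra).
  assert (Ct : 0 < cos t) by (apply Cos; lra).
  assert (A : atan x = t) by (apply atan_tan; lra).
  pose proof (atan_sum_error n x Hx) as E. rewrite A in E.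
  replace (t / (sin t * cos t)) with ((x ^ 2 + 1) * (t / x)).
  + replace (_ - _) with ((x ^ 2 + 1) / x * (atan_sum n x - t)) by (field; lra).
    rewrite Rabs_mult, (Rabs_pos_eq (_ / _)) by (apply Rdiv_le_0_compat; nra).
    apply Rle_trans with ((x ^ 2 + 1) / x * (x ^ (2 * n + 3) / INR (2 * n + 3))).
    * apply Rmult_le_compat_l; [apply Rdiv_le_0_compat; nra | exact E].
    * assert (Q : x ^ (2 * n + 2) <= 1 ^ (2 * n + 2)) by (apply pow_incr; lra).
      assert (0 <= x ^ (2 * n + 2)) by (apply pow_le; lra). rewrite pow1 in Q.
      replace (x ^ (2 * n + 3)) with (x * x ^ (2 * n + 2))
        by (replace (2 * n + 3)%nat with (S (2 * n + 2)) by lia; reflexivity).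
      replace (_ * _) with ((x ^ 2 + 1) * x ^ (2 * n + 2) / INR (2 * n + 3)) by (field; lra).
      apply Rmult_le_compat_r; [apply Rlt_le, Rinv_0_lt_compat, P|]. nra.
  + pose proof (sin2_cos2 t) as T. unfold Rsqr in T.
    replace (x ^ 2 + 1) with ((sin t * sin t + cos t * cos t) / (cos t * cos t))
      by (unfold x, tan; field; lra).
    rewrite T. unfold x, tan. field. lra.
Qed.

(** Two antiderivatives of [t / (sin t * cos t) = t (cot t + tan t)] are used
    on either side of [PI/6], since [cot_int] is handled on [|t| < PI/2] only:
    [H], from [cot t - tan t = 2 cot 2t], involves [cot_int (2 t)] and stops
    short of [PI/4]; [G], from [tan t = cot (PI/2 - t)], involves
    [cot_int (PI/2 - t)] and stops short of 0. *)
Lemma Catalan_cot_int :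
  Catalan = cot_int (PI / 4) + PI / 2 * (ln (cos (PI / 6)) - ln (cos (PI / 4)))
            + / 2 * cot_int (PI / 6) - 3 / 4 * cot_int (PI / 3).
Proof.
pose proof PI_RGT_0 as pi.
set (H := fun t => cot_int t - / 4 * cot_int (2 * t)).
set (G := fun t => / 2 * (cot_int t + cot_int (PI / 2 - t)) - PI / 2 * ln (cos t)).
apply is_series_unique.
replace (_ - _) with ((H (PI / 6) - H 0) + (G (PI / 4) - G (PI / 6))).
2:{ unfold H, G. rewrite Rmult_0_r, cot_int_0.
    replace (2 * (PI / 6)) with (PI / 3) by field.
    replace (PI / 2 - PI / 4) with (PI / 4) by field.
    replace (PI / 2 - PI / 6) with (PI / 3) by field. field. }
apply is_series_of_error with (fun n => / INR (S n) * (PI / 2)).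
- intro n.
  assert (A : Rabs (ti2_sum n (tan (PI / 6)) - ti2_sum n (tan 0) - (H (PI / 6) - H 0))
    <= 2 / INR (2 * n + 3) * (PI / 6 - 0)).
  { apply ti2_sum_error; try lra.
    - intros t Ht.
      assert (St : 0 < sin t) by (apply sin_gt_0; lra).
      assert (Ct : 0 < cos t) by (apply cos_gt_0; lra).
      pose proof (sin2_cos2 t) as T. unfold Rsqr in T.
      replace (t / (sin t * cos t))
        with (1 * (2 * t * cos t / sin t) - / 4 * (2 * (2 * (2 * t) * cos (2 * t) / sin (2 * t)))).
      + apply (is_derive_minus cot_int (fun t => / 4 * cot_int (2 * t)));
          [|apply is_derive_scal].
        * apply (is_derive_cot_int_comp (fun t => t)); [auto_derive; [trivial | ring] | lra].
        * apply (is_derive_cot_int_comp (fun t => 2 * t)); [auto_derive; [trivial | ring] | lra].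
      + rewrite sin_2a, cos_2a.
        replace (t / _) with ((sin t * sin t + cos t * cos t) * t / (sin t * cos t))
          by (rewrite T; field; lra).
        field. lra.
    - intros t Ht. apply (continuous_minus cot_int (fun t => / 4 * cot_int (2 * t))).
      + apply continuous_cot_int. apply Rabs_def1; lra.
      + apply (continuous_scal_r (/ 4) (fun t => cot_int (2 * t))).
        apply continuous_cot_int_comp; [now auto_derive | apply Rabs_def1; lra]. }
  assert (B : Rabs (ti2_sum n (tan (PI / 4)) - ti2_sum n (tan (PI / 6))
    - (G (PI / 4) - G (PI / 6))) <= 2 / INR (2 * n + 3) * (PI / 4 - PI / 6)).
  { assert (D : forall t, PI / 6 <= t <= PI / 4 -> is_derive G t (t / (sin t * cos t))).
    { intros t Ht.
      assert (St : 0 < sin t) by (apply sin_gt_0; lra).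
      assert (Ct : 0 < cos t) by (apply cos_gt_0; lra).
      pose proof (sin2_cos2 t) as T. unfold Rsqr in T.
      replace (t / (sin t * cos t))
        with (/ 2 * (1 * (2 * t * cos t / sin t)
           + (-1) * (2 * (PI / 2 - t) * cos (PI / 2 - t) / sin (PI / 2 - t)))
           - PI / 2 * (- sin t / cos t)).
      - apply (is_derive_minus (fun t => / 2 * (cot_int t + cot_int (PI / 2 - t)))
          (fun t => PI / 2 * ln (cos t))); apply is_derive_scal.
        + apply (is_derive_plus cot_int (fun t => cot_int (PI / 2 - t))).
          * apply (is_derive_cot_int_comp (fun t => t)); [auto_derive; [trivial | ring] | lra].
          * apply (is_derive_cot_int_comp (fun t => PI / 2 - t));
              [auto_derive; [trivial | ring] | lra].
        + auto_derive; [exact Ct | field; lra].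
      - rewrite cos_shift, sin_shift.
        replace (t / _) with ((sin t * sin t + cos t * cos t) * t / (sin t * cos t))
          by (rewrite T; field; lra).
        field. lra. }
    apply ti2_sum_error; try lra.
    - intros t Ht. apply D. lra.
    - intros t Ht. apply (ex_derive_continuous G). eexists. apply D, Ht. }
  assert (E0 : ti2_sum n (tan 0) = 0).
  { rewrite tan_0. apply sum_n_eq_0. intro k. rewrite pow_i by lia. unfold Rdiv. ring. }
  assert (E1 : sum_n (fun k => (-1) ^ k / INR (2 * k + 1) ^ 2) n = ti2_sum n (tan (PI / 4))).
  { rewrite tan_PI4. apply sum_n_ext. intro k. rewrite pow1. now rewrite Rmult_1_r. }
  rewrite E1. rewrite E0 in A.
  assert (Le : 2 / INR (2 * n + 3) <= 2 * / INR (S n)).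
  { apply Rmult_le_compat_l; [lra|]. apply Rinv_le_contravar; [apply lt_0_INR; lia|].
    apply le_INR. lia. }
  apply Rabs_le_between in A. apply Rabs_le_between in B. apply Rabs_le_between.
  assert (2 / INR (2 * n + 3) * (PI / 4) <= 2 * / INR (S n) * (PI / 4))
    by (apply Rmult_le_compat_r; lra).
  lra.
- replace (Finite 0) with (Rbar_mult (Finite 0) (Finite (PI / 2))) by (simpl; f_equal; ring).
  apply is_lim_seq_scal_r, (is_lim_seq_incr_1 (fun k => / INR k)).
  apply (is_lim_seq_inv INR p_infty); [apply is_lim_seq_INR | discriminate].
Qed.

(** * The series *)

(* The binomial coefficient is written [Binomial.C] because Coquelicot's [C] is
   the type of complex numbers. *)
Theorem mainTheorem5 :
  is_series
    (fun k : nat =>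
       Binomial.C (2 * k) k / (INR (2 * k + 1) * 16 ^ k)
       * (3 * S1 (2 * k + 1) + 4 / INR (2 * k + 1)))
    (8 * Catalan).
Proof.
pose proof (is_series_plus _ _ _ _ (is_series_scal 3 _ _ sum_harmonic)
  (is_series_scal 4 _ _ sum_cot_int_coef)) as H.
replace (8 * Catalan) with (plus (scal 3 (harmonic_antideriv (PI / 6) - harmonic_antideriv 0))
  (scal 4 (cot_int (PI / 6)))).
- apply is_series_ext with (2 := H). intro k.
  change (3 * (arcsin_coef k * S1 (2 * k + 1)) + 4 * cot_int_coef k
    = Binomial.C (2 * k) k / (INR (2 * k + 1) * 16 ^ k)
       * (3 * S1 (2 * k + 1) + 4 / INR (2 * k + 1))).
  unfold cot_int_coef, arcsin_coef, inv_cos_coef. field. split; [apply Rgt_not_eq, odd_pos | apply pow_nonzero; lra].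
- change (3 * (harmonic_antideriv (PI / 6) - harmonic_antideriv 0) + 4 * cot_int (PI / 6)
    = 8 * Catalan).
  rewrite Catalan_cot_int. unfold harmonic_antideriv.
  replace (PI / 12 - PI / 6 / 2) with 0 by field.
  replace (5 * PI / 12 - PI / 6 / 2) with (PI / 3) by field.
  replace (PI / 12 - 0 / 2) with (PI / 12) by field.
  replace (5 * PI / 12 - 0 / 2) with (5 * PI / 12) by field.
  replace (cos (PI / 6)) with (sin (PI / 3)) by apply sin_PI3_cos_PI6.
  replace (cos (PI / 4)) with (sin (PI / 4)) by now rewrite cos_PI4, sin_PI4.
  rewrite cot_int_0. pose proof cot_int_triplication as T. lra.
Qed.
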